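(* Let $\mathcal{O}$ be an order in an imaginary quadratic field with discriminant $\Delta$, and suppose $|\Delta|>12$. Let $\tau=\sqrt{\Delta}/2$ if $\Delta$ is even and $\tau=(1+\sqrt{\Delta})/2$ if $\Delta$ is odd. Then $\mathrm{PE}_2(\mathcal{O})$ has the presentation $$\mathrm{PE}_2(\mathcal{O})=\big\langle r,\ s(1),\ s(\tau)\;\big|\;s(1)s(\tau)s(1)^{-1}s(\tau)^{-1},\ r^2,\ (rs(1))^3\big\rangle.$$
   Context: $\mathrm{PE}_2(\mathcal{O})$, the projective elementary group, is the subgroup of $\mathrm{PSL}_2(\mathcal{O})$ generated by the (classes of) elementary matrices, i.e. the diagonal, (upper or lower) triangular, or permutation matrices in $\mathrm{PSL}_2(\mathcal{O})$. Notation for elements of $\mathrm{PSL}_2(\mathcal{O})$: $r=\begin{bmatrix}0&-1\\1&0\end{bmatrix}$ and $s(\alpha)=\begin{bmatrix}1&\alpha\\0&1\end{bmatrix}$ for $\alpha\in\mathcal{O}$. The order $\mathcal{O}$ is not assumed to be maximal. *)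

(* Defs.v *)
From HB Require Import structures.
From mathcomp Require Import all_boot all_order perm all_algebra all_field.

Set Implicit Arguments.
Unset Strict Implicit.
Unset Printing Implicit Defensive.

Import Order.TTheory GRing.Theory Num.Theory.
Local Open Scope ring_scope.

(** Number fields and orders *)

(* "Imaginary": no field embedding of [K] into the complex (algebraic) numbers
   has real image. *)
Definition imaginary_quadratic (K : fieldExtType rat) : Prop :=
  \dim {:K} = 2 /\
  forall f : {rmorphism K -> algC}, exists x : K, f x \isn't Num.real.

(* [b] is a basis of [K] over the rationals, and the subring [O] is the
   lattice of its integer combinations. *)
Definition integral_basis (K : fieldExtType rat) (O : subringClosed K)
    (n : nat) (b : n.-tuple K) : Prop :=
  basis_of fullv b /\
  forall x : K, x \in O <-> exists c : 'I_n -> int, x = \sum_(i < n) b`_i *~ c i.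

Definition is_order (K : fieldExtType rat) (O : subringClosed K) : Prop :=
  exists (n : nat) (b : n.-tuple K), integral_basis O b.

Definition field_trace (K : fieldExtType rat) (x : K) : rat :=
  \tr (passmx.mxof (vbasis {:K}) (vbasis {:K}) (amull x)).

Definition is_discriminant (K : fieldExtType rat) (O : subringClosed K)
    (Delta : int) : Prop :=
  exists (n : nat) (b : n.-tuple K),
    integral_basis O b /\
    \det (\matrix_(i < n, j < n) field_trace (b`_i * b`_j)) = Delta%:~R.

(* The elements of [O], as a commutative ring in its own right. *)
Record ring_of (K : fieldExtType rat) (O : subringClosed K) :=
  RingOf { ring_val :> K; _ : ring_val \in O }.

HB.instance Definition _ (K : fieldExtType rat) (O : subringClosed K) :=
  [isSub for @ring_val K O].
HB.instance Definition _ (K : fieldExtType rat) (O : subringClosed K) :=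
  [Choice of ring_of O by <:].
HB.instance Definition _ (K : fieldExtType rat) (O : subringClosed K) :=
  [SubChoice_isSubComNzRing of ring_of O by <:].

(** SL_2 and PSL_2 *)

Record SL2 (R : comNzRingType) := SL2Of {
  SL2_val :> 'M[R]_2;
  SL2_det : \det SL2_val == 1 }.

HB.instance Definition _ (R : comNzRingType) := [isSub for @SL2_val R].
HB.instance Definition _ (R : comNzRingType) := [Choice of SL2 R by <:].

Section SL2Group.
Variable R : comNzRingType.
Implicit Types A B C : SL2 R.

Fact SL2_one_det : \det (1%:M : 'M[R]_2) == 1.
Proof. by rewrite det1. Qed.

Fact SL2_mul_det A B : \det (SL2_val A *m SL2_val B) == 1.
Proof. by rewrite det_mulmx (eqP (SL2_det A)) (eqP (SL2_det B)) mulr1. Qed.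

Fact SL2_inv_det A : \det (\adj (SL2_val A)) == 1.
Proof.
have := congr1 determinant (mul_mx_adj (SL2_val A)).
by rewrite det_mulmx (eqP (SL2_det A)) mul1r det1 => ->.
Qed.

Definition SL2_one : SL2 R := SL2Of SL2_one_det.
Definition SL2_mul A B : SL2 R := SL2Of (SL2_mul_det A B).
Definition SL2_inv A : SL2 R := SL2Of (SL2_inv_det A).

Fact SL2_mulA : associative SL2_mul.
Proof. by move=> A B C; apply/val_inj; rewrite /= mulmxA. Qed.
Fact SL2_mul1 : left_id SL2_one SL2_mul.
Proof. by move=> A; apply/val_inj; rewrite /= mul1mx. Qed.
Fact SL2_1mul : right_id SL2_one SL2_mul.
Proof. by move=> A; apply/val_inj; rewrite /= mulmx1. Qed.
Fact SL2_mulV : left_inverse SL2_one SL2_inv SL2_mul.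
Proof. by move=> A; apply/val_inj; rewrite /= mul_adj_mx (eqP (SL2_det A)). Qed.
Fact SL2_Vmul : right_inverse SL2_one SL2_inv SL2_mul.
Proof. by move=> A; apply/val_inj; rewrite /= mul_mx_adj (eqP (SL2_det A)). Qed.

HB.instance Definition _ :=
  isGroup.Build (SL2 R) SL2_mulA SL2_mul1 SL2_1mul SL2_mulV SL2_Vmul.

Definition PSL2_rel A B : bool :=
  (SL2_val A == SL2_val B) || (SL2_val A == - SL2_val B).

Fact PSL2_rel_refl : reflexive PSL2_rel.
Proof. by move=> A; rewrite /PSL2_rel eqxx. Qed.
Fact PSL2_rel_sym : symmetric PSL2_rel.
Proof.
by move=> A B; rewrite /PSL2_rel eq_sym; congr orb; rewrite -eqr_oppLR eq_sym.
Qed.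
Fact PSL2_rel_trans : transitive PSL2_rel.
Proof.
move=> B A C; rewrite /PSL2_rel.
by case/orP=> /eqP->; case/orP=> /eqP->; rewrite ?opprK ?eqxx ?orbT.
Qed.

Canonical PSL2_equiv :=
  EquivRel PSL2_rel PSL2_rel_refl PSL2_rel_sym PSL2_rel_trans.
End SL2Group.

Local Open Scope quotient_scope.

(* SL_2(R) modulo the subgroup {1, -1}, which for an integral domain [R] is the
   group of scalar matrices in SL_2(R). *)
Definition PSL2 (R : comNzRingType) : Type := {eq_quot @PSL2_rel R}.

HB.instance Definition _ (R : comNzRingType) := EqQuotient.on (PSL2 R).
HB.instance Definition _ (R : comNzRingType) := Choice.on (PSL2 R).

Definition PSL2_class (R : comNzRingType) (A : SL2 R) : PSL2 R := \pi_(PSL2 R) A.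

Section PSL2Group.
Variable R : comNzRingType.
Implicit Types (A B : SL2 R) (x y : PSL2 R).

Definition PSL2_one : PSL2 R := PSL2_class (SL2_one R).
Definition PSL2_mul x y : PSL2 R := PSL2_class (SL2_mul (repr x) (repr y)).
Definition PSL2_inv x : PSL2 R := PSL2_class (SL2_inv (repr x)).

Lemma PSL2_classP A B : reflect (PSL2_class A = PSL2_class B) (PSL2_rel A B).
Proof. exact: eqmodP. Qed.

Lemma PSL2_repr A : PSL2_rel (repr (PSL2_class A)) A.
Proof. by apply/PSL2_classP; rewrite /PSL2_class reprK. Qed.

Lemma PSL2_classM A B :
  PSL2_mul (PSL2_class A) (PSL2_class B) = PSL2_class (SL2_mul A B).
Proof.
apply/PSL2_classP; have := PSL2_repr A; have := PSL2_repr B.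
rewrite /PSL2_rel /= => /orP[] /eqP-> /orP[] /eqP->;
  by rewrite ?mulmxN ?mulNmx ?opprK ?eqxx ?orbT.
Qed.

Lemma PSL2_classV A : PSL2_inv (PSL2_class A) = PSL2_class (SL2_inv A).
Proof.
suff h B C : PSL2_rel B C -> PSL2_class (SL2_inv B) = PSL2_class (SL2_inv C).
  exact/h/PSL2_repr.
move=> /orP hBC; apply/PSL2_classP; rewrite /PSL2_rel /=.
case: hBC => /eqP->; first by rewrite eqxx.
by rewrite -scaleN1r adjZ expr1 scaleN1r eqxx orbT.
Qed.

Lemma PSL2_ind (P : PSL2 R -> Prop) :
  (forall A, P (PSL2_class A)) -> forall x, P x.
Proof. by move=> h x; rewrite -[x]reprK; exact: h. Qed.

Fact PSL2_mulA : associative PSL2_mul.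
Proof.
elim/PSL2_ind=> A; elim/PSL2_ind=> B; elim/PSL2_ind=> C.
by rewrite !PSL2_classM SL2_mulA.
Qed.
Fact PSL2_mul1 : left_id PSL2_one PSL2_mul.
Proof. by elim/PSL2_ind=> A; rewrite PSL2_classM SL2_mul1. Qed.
Fact PSL2_1mul : right_id PSL2_one PSL2_mul.
Proof. by elim/PSL2_ind=> A; rewrite PSL2_classM SL2_1mul. Qed.
Fact PSL2_mulV : left_inverse PSL2_one PSL2_inv PSL2_mul.
Proof. by elim/PSL2_ind=> A; rewrite PSL2_classV PSL2_classM SL2_mulV. Qed.
Fact PSL2_Vmul : right_inverse PSL2_one PSL2_inv PSL2_mul.
Proof. by elim/PSL2_ind=> A; rewrite PSL2_classV PSL2_classM SL2_Vmul. Qed.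

HB.instance Definition _ :=
  isGroup.Build (PSL2 R) PSL2_mulA PSL2_mul1 PSL2_1mul PSL2_mulV PSL2_Vmul.
End PSL2Group.

(** The projective elementary group *)

Inductive subgroup_generated (G : groupType) (S : G -> Prop) : G -> Prop :=
| sg_gen x : S x -> subgroup_generated S x
| sg_one : subgroup_generated S 1%g
| sg_mul x y : subgroup_generated S x -> subgroup_generated S y ->
    subgroup_generated S (x * y)%g
| sg_inv x : subgroup_generated S x -> subgroup_generated S x^-1%g.

(* Permutation matrices up to the signs of their entries: an honest
   transposition matrix has determinant -1, and it is its signed version
   [[0, -1], [1, 0]] that lies in SL_2. *)
Definition is_signed_perm_mx (R : comNzRingType) (A : 'M[R]_2) : Prop :=
  exists (e : 'I_2 -> bool) (s : 'S_2),
    A = diag_mx (\row_i (-1) ^+ e i) *m perm_mx s.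

(* Diagonal, lower triangular, upper triangular, or permutation matrices. *)
Definition elementary_mx (R : comNzRingType) (A : 'M[R]_2) : Prop :=
  [\/ is_diag_mx A, is_trig_mx A, is_trig_mx A^T | is_signed_perm_mx A].

Definition PE2 (R : comNzRingType) : PSL2 R -> Prop :=
  subgroup_generated
    (fun x => exists2 A : SL2 R, elementary_mx A & x = PSL2_class A).

Definition mx22 (R : comNzRingType) (a b c d : R) : 'M[R]_2 :=
  \matrix_(i, j) if i == 0 then (if j == 0 then a else b)
                 else (if j == 0 then c else d).

Lemma det_mx22 (R : comNzRingType) (a b c d : R) :
  \det (mx22 a b c d) = a * d - b * c.
Proof.
rewrite (expand_det_row _ 0) !big_ord_recl big_ord0 /cofactor !det_mx11 !mxE /=.
by rewrite addr0 expr0 expr1 mul1r mulN1r mulrN.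
Qed.

Fact r_det (R : comNzRingType) : \det (mx22 0 (-1) 1 0 : 'M[R]_2) == 1.
Proof. by rewrite det_mx22 mul0r sub0r mulr1 opprK. Qed.

Fact s_det (R : comNzRingType) (a : R) : \det (mx22 1 a 0 1) == 1.
Proof. by rewrite det_mx22 mulr0 subr0 mulr1. Qed.

Definition PSL2_r (R : comNzRingType) : PSL2 R := PSL2_class (SL2Of (r_det R)).
Definition PSL2_s (R : comNzRingType) (a : R) : PSL2 R :=
  PSL2_class (SL2Of (s_det a)).

(** Group presentations *)

(* Words in the letters [(i, false)], standing for the generator [i], and
   [(i, true)], standing for its formal inverse. *)
Definition word (I : Type) : Type := seq (I * bool).

Definition eval_letter (I : Type) (G : groupType) (g : I -> G) (l : I * bool) : G :=
  (if l.2 then (g l.1)^-1 else g l.1)%g.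

Definition eval_word (I : Type) (G : groupType) (g : I -> G) (w : word I) : G :=
  foldr (fun l x => (eval_letter g l * x)%g) 1%g w.

(* Equality of two words in the presented group < I | rels >, i.e. in the
   quotient of the free group on [I] by the normal closure of [rels]. *)
Inductive presented_eq (I : Type) (rels : word I -> Prop) : word I -> word I -> Prop :=
| pe_refl w : presented_eq rels w w
| pe_sym v w : presented_eq rels v w -> presented_eq rels w v
| pe_trans u v w :
    presented_eq rels u v -> presented_eq rels v w -> presented_eq rels u w
| pe_cancel u v i e :
    presented_eq rels (u ++ [:: (i, e); (i, ~~ e)] ++ v) (u ++ v)
| pe_relator u v r : rels r -> presented_eq rels (u ++ r ++ v) (u ++ v).

(* The subgroup [H] has the presentation < g | rels >: sending [i] to [g i]
   induces an isomorphism from the presented group onto [H]. *)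
Definition has_presentation (I : Type) (G : groupType) (H : G -> Prop)
    (g : I -> G) (rels : word I -> Prop) : Prop :=
  [/\ forall w, H (eval_word g w),
      forall x, H x -> exists w, eval_word g w = x
    & forall v w, eval_word g v = eval_word g w <-> presented_eq rels v w].

Variant PE2_gen : Type := gen_r | gen_s1 | gen_stau.

Definition PE2_gen_val (R : comNzRingType) (tau : R) (i : PE2_gen) : PSL2 R :=
  match i with
  | gen_r => PSL2_r R
  | gen_s1 => PSL2_s 1
  | gen_stau => PSL2_s tau
  end.

Variant PE2_relator : word PE2_gen -> Prop :=
| rel_commutator : PE2_relator
    [:: (gen_s1, false); (gen_stau, false); (gen_s1, true); (gen_stau, true)]
| rel_r2 : PE2_relator [:: (gen_r, false); (gen_r, false)]
| rel_rs3 : PE2_relator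
    [:: (gen_r, false); (gen_s1, false);
        (gen_r, false); (gen_s1, false);
        (gen_r, false); (gen_s1, false)].

(* Main.v *)
(** A discretely normed ring (every element other than 0, 1, -1 has absolute
    value at least 2) is universal for GL_2 in the sense of Cohn. Modulo the
    relators, every word can be brought to the form
    [s(a0) r s(a1) r ... r s(an)] with [a1, ..., a(n-1)] outside {0, 1, -1}:
    an inner [s(0)] disappears by [r^2 = 1], and an inner [s(1)] or [s(-1)] by
    [r s(e) r = s(-e) r s(-e)]. Applying the matrix of such a word to the first
    basis vector, the sizes of the coordinates [(x, y)] satisfy [|x| > |y|]
    before every [r], because [|a x - y| >= 2 |x| - |y| > |x|]; so the lower
    left entry is nonzero as soon as [n > 0], and the word is not trivial.
    An order of discriminant [Delta < -12] is discretely normed: it is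
    [Z + Z tau], and [4 |k + h tau|^2 = (2 k + h p)^2 + h^2 |Delta|], where [p]
    is the parity of [Delta], is at least 16 when [h] is nonzero, because
    [|Delta| >= 16] if [p = 0], whereas if [p = 1] then [|Delta| >= 15] and the
    first square is odd for [h = 1] and [h = -1]. *)

Require Import Defs.
From HB Require Import structures.
From mathcomp Require Import all_boot all_order all_algebra all_field.
From mathcomp Require Import perm ring zify.
From Stdlib Require Import Setoid Morphisms.
Import Order.TTheory GRing.Theory Num.Theory.
Local Open Scope ring_scope.

Set Implicit Arguments.
Unset Strict Implicit.
Unset Printing Implicit Defensive.

(** * Words in a presented group: congruence, inverses and evaluation *)

Section PresentedGroup.
Variables (I : Type) (rels : word I -> Prop).
Local Notation "v ~~~ w" := (presented_eq rels v w) (at level 70).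

(** The cancellation and relator rules already carry arbitrary contexts, so enlarging the context
    gives another instance of the same rule. *)
Lemma presented_eq_context u v w x :
  v ~~~ w -> (u ++ v ++ x) ~~~ (u ++ w ++ x).
Proof.
elim=> {v w} [w|v w _|v w y _ IH1 _ IH2|v w i e|v w r rel_r].
- exact: pe_refl.
- exact: pe_sym.
- exact: pe_trans IH1 IH2.
- by have := pe_cancel rels (u ++ v) (w ++ x) i e; rewrite -!catA.
- by have := pe_relator (u ++ v) (w ++ x) rel_r; rewrite -!catA.
Qed.

#[global] Instance presented_eq_equiv : Equivalence (presented_eq rels).
Proof. split; [exact: pe_refl | exact: pe_sym | exact: pe_trans]. Qed.

#[global] Instance cat_presented_eq :
  Proper (presented_eq rels ==> presented_eq rels ==> presented_eq rels) cat.
Proof.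
move=> v v' Hv w w' Hw; transitivity (v' ++ w).
  exact: (presented_eq_context [::] w Hv).
by have := presented_eq_context v' [::] Hw; rewrite !cats0.
Qed.

(** Setoid rewriting is set up under [cat] but not under [::]; this bridges the two. *)
Lemma cons_cat1 (l : I * bool) w : l :: w = [:: l] ++ w. Proof. by []. Qed.

Lemma letter_mulV i e : ([:: (i, e)] ++ [:: (i, ~~ e)]) ~~~ [::].
Proof. exact: (pe_cancel rels [::] [::] i e). Qed.

Lemma letter_mulVK i e w : ([:: (i, e)] ++ [:: (i, ~~ e)] ++ w) ~~~ w.
Proof. exact: (pe_cancel rels [::] w i e). Qed.

Definition inv_word (w : word I) : word I := rev [seq (l.1, ~~ l.2) | l <- w].

Lemma inv_word_mul w : (inv_word w ++ w) ~~~ [::].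
Proof.
elim: w => [|[i e] w IH]; first exact: pe_refl.
rewrite /inv_word /= rev_cons -cats1 -catA /=.
rewrite -[e in _ :: (i, e) :: w]negbK.
apply: pe_trans IH; exact: (pe_cancel rels (inv_word w) w i (~~ e)).
Qed.

Definition commuting_words (v w : word I) : Prop := (v ++ w) ~~~ (w ++ v).

Lemma commuting_words_sym v w : commuting_words v w -> commuting_words w v.
Proof. exact: pe_sym. Qed.

(** With $t$ the letter, $v t^{-1} = t^{-1}(t v)t^{-1} = t^{-1}(v t)t^{-1} = t^{-1}v$. *)
Lemma commuting_letterV v i e :
  commuting_words v [:: (i, e)] -> commuting_words v [:: (i, ~~ e)].
Proof.
rewrite /commuting_words => vi.
have -> : (v ++ [:: (i, ~~ e)]) ~~~
   ([:: (i, ~~ e)] ++ ([:: (i, e)] ++ v) ++ [:: (i, ~~ e)]).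
  rewrite -!catA -{3}[e]negbK; symmetry; exact: letter_mulVK.
rewrite -vi -catA letter_mulV cats0; exact: pe_refl.
Qed.

Definition letter_power (i : I) (m : int) : word I :=
  match m with Posz n => nseq n (i, false) | Negz n => nseq n.+1 (i, true) end.

Definition letter_sign (e : bool) : int := if e then -1 else 1.

Lemma cons_letter_power i e m :
  ((i, e) :: letter_power i m) ~~~ letter_power i (letter_sign e + m).
Proof.
case: e; case: m => [[|n]|n]; try exact: pe_refl.
- have -> : letter_sign true + n.+1 = n :> int by rewrite /= -addn1 PoszD addrC addrK.
  exact: letter_mulVK i true _.
- have -> : letter_sign false + Negz n = - n%:Z.
    by rewrite /= NegzE -addn1 PoszD opprD addrC addrNK.
  case: n => [|n] /=; exact: letter_mulVK i false _.
Qed.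

Lemma commuting_letter_power v i m :
  commuting_words v [:: (i, false)] -> commuting_words v (letter_power i m).
Proof.
have comm_nseq e n : commuting_words v [:: (i, e)] ->
    commuting_words v (nseq n (i, e)).
  rewrite /commuting_words => vi; elim: n => [|n IH] /=.
    by rewrite cats0; exact: pe_refl.
  rewrite (cons_cat1 _ (nseq n _)) catA vi -catA IH catA. exact: pe_refl.
move=> vi; case: m => n; apply: comm_nseq => //.
exact: (@commuting_letterV v i false).
Qed.

Lemma eval_word_cat (G : groupType) (g : I -> G) v w :
  eval_word g (v ++ w) = (eval_word g v * eval_word g w)%g.
Proof. by elim: v => [|l v IH] /=; rewrite ?mul1g // IH mulgA. Qed.

Lemma eval_word_letter (G : groupType) (g : I -> G) l :
  eval_word g [:: l] = eval_letter g l.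
Proof. by rewrite /= mulg1. Qed.

Lemma eval_inv_word (G : groupType) (g : I -> G) w :
  eval_word g (inv_word w) = (eval_word g w)^-1%g.
Proof.
elim: w => [|[i e] w IH]; first by rewrite invg1.
rewrite /inv_word /= rev_cons -cats1 eval_word_cat IH eval_word_letter invgM.
by rewrite /eval_letter /=; case: e; rewrite ?invgK.
Qed.

(** Von Dyck's argument: an assignment of the generators that kills the relators factors through the
    presented group. *)
Lemma presented_eq_eval (G : groupType) (g : I -> G) :
  (forall r, rels r -> eval_word g r = 1%g) ->
  forall v w, v ~~~ w -> eval_word g v = eval_word g w.
Proof.
move=> rel1 v w; elim=> {v w} // [u v w _ -> _ -> //|u v i e|u v r rel_r].
  rewrite !eval_word_cat; congr (_ * _)%g; rewrite /= /eval_letter /=.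
  by case: e => /=; rewrite mulg1 (mulVg, mulgV) mul1g.
by rewrite !eval_word_cat (rel1 _ rel_r) mul1g.
Qed.

(** Injectivity reduces to a trivial kernel, applied to [v ++ inv_word w]. *)
Lemma eval_presented_eq (G : groupType) (g : I -> G) :
  (forall r, rels r -> eval_word g r = 1%g) ->
  (forall w, eval_word g w = 1%g -> w ~~~ [::]) ->
  forall v w, eval_word g v = eval_word g w -> v ~~~ w.
Proof.
move=> rel1 ker1 v w eq_vw.
have vw1 : (v ++ inv_word w) ~~~ [::].
  by apply: ker1; rewrite eval_word_cat eval_inv_word eq_vw mulgV.
transitivity (v ++ inv_word w ++ w); last by rewrite catA vw1; exact: pe_refl.
by rewrite inv_word_mul cats0; exact: pe_refl.
Qed.

End PresentedGroup.

(** * Normal forms of words modulo the three relators *)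

Section NormalForms.
Local Notation "v ~~~ w" := (presented_eq PE2_relator v w) (at level 70).
Local Notation "[ 'r' ]" := [:: (gen_r, false)] (at level 0).
Local Notation coeffs := (int * int)%type.

(** The canonical word for $s(a_1 + a_2\tau)$; the commutator relator lets such words add. *)
Definition translation_word (a : coeffs) : word PE2_gen :=
  letter_power gen_s1 a.1 ++ letter_power gen_stau a.2.
Local Notation T := translation_word.

Lemma commuting_s1_stau : commuting_words PE2_relator
  [:: (gen_stau, false)] [:: (gen_s1, false)].
Proof.
have rel : ([:: (gen_s1, false)] ++ [:: (gen_stau, false)] ++
    [:: (gen_s1, true)] ++ [:: (gen_stau, true)]) ~~~ [::].
  exact: (pe_relator [::] [::] rel_commutator).
set s := [:: (gen_s1, false)] in rel *; set t := [:: (gen_stau, false)] in rel *.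
(* Putting the commutator in front of $ts$ gives $s t s^{-1} t^{-1} t s$, which cancels to $st$. *)
rewrite /commuting_words; rewrite -[X in X ~~~ _]cat0s -rel -!catA.
rewrite (letter_mulVK _ gen_stau true) (letter_mulV _ gen_s1 true) cats0.
exact: pe_refl.
Qed.

Lemma cons_s1_translation e a :
  ((gen_s1, e) :: T a) ~~~ T (letter_sign e + a.1, a.2).
Proof.
rewrite /T /= -cat_cons cons_letter_power; exact: pe_refl.
Qed.

Lemma cons_stau_translation e a :
  ((gen_stau, e) :: T a) ~~~ T (a.1, letter_sign e + a.2).
Proof.
have comm : commuting_words PE2_relator [:: (gen_stau, e)]
                                        (letter_power gen_s1 a.1).
  apply: commuting_letter_power; case: e; last exact: commuting_s1_stau.
  apply/commuting_words_sym/(@commuting_letterV _ _ _ _ false).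
  exact/commuting_words_sym/commuting_s1_stau.
rewrite /T /= cons_cat1 catA comm -catA -cons_letter_power; reflexivity.
Qed.

Lemma translation_wordD a b : (T a ++ T b) ~~~ T (a + b).
Proof.
have nseq_s1 e n c : (nseq n (gen_s1, e) ++ T c) ~~~
    T (letter_sign e *+ n + c.1, c.2).
  elim: n => [|n IH] /=; first by rewrite mulr0n add0r; case: c; reflexivity.
  rewrite cons_cat1 IH -cons_cat1 cons_s1_translation /= mulrS addrA; reflexivity.
have nseq_stau e n c : (nseq n (gen_stau, e) ++ T c) ~~~
    T (c.1, letter_sign e *+ n + c.2).
  elim: n => [|n IH] /=; first by rewrite mulr0n add0r; case: c; reflexivity.
  rewrite cons_cat1 IH -cons_cat1 cons_stau_translation /= mulrS addrA; reflexivity.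
have mulN1n n : (-1 : int) *+ n.+1 = Negz n by rewrite NegzE mulNrn natz.
have powD1 m c : (letter_power gen_s1 m ++ T c) ~~~ T (m + c.1, c.2).
  by case: m => n; rewrite ?nseq_s1 ?natz ?mulN1n; reflexivity.
have powDt m c : (letter_power gen_stau m ++ T c) ~~~ T (c.1, m + c.2).
  by case: m => n; rewrite ?nseq_stau ?natz ?mulN1n; reflexivity.
rewrite {1}/T -catA powDt powD1 /=; case: a b => [a1 a2] [b1 b2]; reflexivity.
Qed.

Lemma r_r : ([r] ++ [r]) ~~~ [::].
Proof. exact: (pe_relator [::] [::] rel_r2). Qed.

Lemma r_inv : [:: (gen_r, true)] ~~~ [r].
Proof.
transitivity ([:: (gen_r, true)] ++ [r] ++ [r]); first by rewrite r_r; reflexivity.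
exact: letter_mulVK.
Qed.

(** Since $q = p^{-1}$ and $r^2 = 1$, the product $(rp)^3 qrq$ collapses to $rpr$. Multiplying $rpr
    = qrq$ by $r$ on the left and by $p$ on the right gives the second relation. *)
Lemma r_conj_braid (p q : word PE2_gen) :
    (p ++ q) ~~~ [::] -> (q ++ p) ~~~ [::] ->
    ([r] ++ p ++ [r] ++ p ++ [r] ++ p) ~~~ [::] ->
  ([r] ++ p ++ [r]) ~~~ (q ++ [r] ++ q) /\ ([r] ++ q ++ [r]) ~~~ (p ++ [r] ++ p).
Proof.
move=> pq qp rel.
have rpr : ([r] ++ p ++ [r]) ~~~ (q ++ [r] ++ q).
  transitivity (([r] ++ p ++ [r] ++ p ++ [r] ++ p) ++ q ++ [r] ++ q);
    last by rewrite rel; reflexivity.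
  rewrite -!catA (catA p q) pq cat0s (catA [r] [r]) r_r cat0s pq cats0; reflexivity.
split=> //; transitivity ([r] ++ ([r] ++ p ++ [r]) ++ p).
  rewrite rpr -!catA qp cats0; reflexivity.
rewrite -!catA (catA [r] [r]) r_r; reflexivity.
Qed.

Lemma r_s_r :
  ([r] ++ T (1, 0) ++ [r]) ~~~ (T (-1, 0) ++ [r] ++ T (-1, 0)) /\
  ([r] ++ T (-1, 0) ++ [r]) ~~~ (T (1, 0) ++ [r] ++ T (1, 0)).
Proof.
apply: r_conj_braid.
- by rewrite translation_wordD; reflexivity.
- by rewrite translation_wordD; reflexivity.
- exact: (pe_relator [::] [::] rel_rs3).
Qed.

(* [normal_word a [:: b1; ..; bn]] is the word
   [s(a) r s(b1) r ... r s(bn)]. *)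
Fixpoint normal_word (a : coeffs) (s : seq coeffs) : word PE2_gen :=
  if s is b :: s' then T a ++ [r] ++ normal_word b s' else T a.

(** The coordinates of 0, 1 and -1: the translations that can be eliminated between two letters
    [r]. *)
Definition small_coeffs : seq coeffs := [:: 0; (1, 0); (-1, 0)].

(* The last entry, which is not enclosed between two letters [r], is free. *)
Fixpoint reduced (s : seq coeffs) : bool :=
  if s is b :: s' then ((s' == [::]) || (b \notin small_coeffs)) && reduced s'
  else true.

Lemma translation_normal_word c a s :
  (T c ++ normal_word a s) ~~~ normal_word (c + a) s.
Proof.
case: s => [|b s] /=; first exact: translation_wordD.
rewrite catA translation_wordD; reflexivity.
Qed.

(** A new [r] encloses the leading coefficient [a]. If [a] is small, the word shortens, possibly
    leaving an [r] before a shorter normal word with another leading coefficient; hence the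
    induction on [s] with [a] arbitrary. *)
Lemma r_normal_word a s : reduced s ->
  exists a' s', reduced s' /\ ([r] ++ normal_word a s) ~~~ normal_word a' s'.
Proof.
elim: s a => [|b s IH] a.
  by move=> _; exists 0, [:: a]; split=> //=; reflexivity.
move=> red_bs; have red_s : reduced s by case/andP: red_bs.
have [|a_big] := boolP (a \in small_coeffs); last first.
  (* The new leading coefficient is 0, whose translation word is empty. *)
  by exists 0, (a :: b :: s); split; [rewrite /= a_big | reflexivity].
(* [r s(e) r = s(-e) r s(-e)] removes one letter [r]. *)
have step e : ([r] ++ T e ++ [r]) ~~~ (T (- e) ++ [r] ++ T (- e)) ->
    exists a' s', reduced s' /\
      ([r] ++ normal_word e (b :: s)) ~~~ normal_word a' s'.
  move=> rer; have [a' [s' [red_s' eq_s']]] := IH (- e + b) red_s.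
  exists (- e + a'), s'; split=> //.
  rewrite -translation_normal_word -eq_s' -translation_normal_word.
  transitivity (([r] ++ T e ++ [r]) ++ normal_word b s).
    by rewrite /= -?catA; reflexivity.
  by rewrite rer -!catA; reflexivity.
rewrite !inE => /or3P[] /eqP->.
- exists b, s; split=> //=.
  transitivity (([r] ++ [r]) ++ normal_word b s); first by reflexivity.
  by rewrite r_r; reflexivity.
- by apply: step; exact: r_s_r.1.
- by apply: step; exact: r_s_r.2.
Qed.

Lemma exists_normal_word w :
  exists a s, reduced s /\ w ~~~ normal_word a s.
Proof.
elim: w => [|[i e] w [a [s [red_s eq_w]]]].
  by exists 0, [::]; split=> //; reflexivity.
have cons_w : ((i, e) :: w) ~~~ ([:: (i, e)] ++ normal_word a s).
  by rewrite cons_cat1 eq_w; reflexivity.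
case: i cons_w => cons_w.
- have [a' [s' [red_s' eq_s']]] := r_normal_word a red_s.
  exists a', s'; split=> //; rewrite -eq_s' cons_w.
  by case: e cons_w => _; rewrite ?r_inv; reflexivity.
- exists ((letter_sign e, 0) + a), s; split=> //.
  by rewrite -translation_normal_word cons_w; case: e cons_w => _; reflexivity.
- exists ((0, letter_sign e) + a), s; split=> //.
  by rewrite -translation_normal_word cons_w; case: e cons_w => _; reflexivity.
Qed.

End NormalForms.

(** * Two-by-two matrices and the relators in PSL_2 *)

Section Matrices22.
Variable R : comNzRingType.
Implicit Types (a b c d : R) (A B : SL2 R).

Lemma ord2_case (i : 'I_2) : i = 0 \/ i = 1.
Proof. by case: i => [[|[|//]] lt_i2]; [left|right]; apply: val_inj. Qed.

Lemma mx22_eta (A : 'M[R]_2) : A = mx22 (A 0 0) (A 0 1) (A 1 0) (A 1 1).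
Proof.
apply/matrixP=> i j; rewrite mxE.
by case: (ord2_case i) => ->; case: (ord2_case j) => ->.
Qed.

Lemma mul_mx22 a b c d a' b' c' d' :
  mx22 a b c d *m mx22 a' b' c' d' =
  mx22 (a * a' + b * c') (a * b' + b * d') (c * a' + d * c') (c * b' + d * d').
Proof.
apply/matrixP=> i j; rewrite !mxE !big_ord_recl big_ord0 !mxE /= addr0.
by case: ifP => _; case: ifP => _.
Qed.

Lemma opp_mx22 a b c d : - mx22 a b c d = mx22 (- a) (- b) (- c) (- d).
Proof. by apply/matrixP=> i j; rewrite !mxE; do 2 case: ifP => _. Qed.

Lemma SL2_det_eq1 A : A 0 0 * A 1 1 - A 0 1 * A 1 0 = 1.
Proof. by have /eqP := SL2_det A; rewrite {1}[SL2_val A]mx22_eta det_mx22. Qed.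

Lemma SL2_eqP A B : A = B :> 'M_2 -> A = B. Proof. exact: val_inj. Qed.

Lemma PSL2_class_mul A B :
  (PSL2_class A * PSL2_class B)%g = PSL2_class (SL2_mul A B).
Proof. exact: PSL2_classM. Qed.

Lemma PSL2_class_eqN A B : SL2_val A = - SL2_val B -> PSL2_class A = PSL2_class B.
Proof. by move=> AB; apply/PSL2_classP; rewrite /PSL2_rel AB eqxx orbT. Qed.

Lemma PSL2_class_eq1 A : PSL2_class A = 1%g -> A 1 0 = 0 /\ (A 0 0 = 1 -> A 0 1 = 0).
Proof.
move/PSL2_classP/orP=> [] /eqP->; rewrite !mxE /= ?oppr0 //.
Qed.

Lemma PSL2_sD a b : (PSL2_s a * PSL2_s b)%g = PSL2_s (a + b).
Proof.
rewrite PSL2_class_mul; congr PSL2_class; apply: SL2_eqP => /=.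
by rewrite mul_mx22; congr mx22; ring.
Qed.

Lemma PSL2_s0 : PSL2_s (0 : R) = 1%g.
Proof.
apply/PSL2_classP/orP; left; apply/eqP; rewrite /= [RHS]mx22_eta !mxE //.
Qed.

Lemma PSL2_sV a : (PSL2_s a)^-1%g = PSL2_s (- a).
Proof.
by apply: mulg1_eq; rewrite PSL2_sD addrN PSL2_s0.
Qed.

Lemma PSL2_r2 : (PSL2_r R * PSL2_r R)%g = 1%g.
Proof.
rewrite PSL2_class_mul; apply: PSL2_class_eqN => /=.
by rewrite mul_mx22 [1%:M]mx22_eta opp_mx22 !mxE /=; congr mx22; ring.
Qed.

Lemma PE2_gen_relators (tau : R) w :
  PE2_relator w -> eval_word (PE2_gen_val tau) w = 1%g.
Proof.
case=> {w}; rewrite /= /eval_letter /= ?mulg1.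
- by rewrite !PSL2_sV !PSL2_sD -PSL2_s0; congr PSL2_s; ring.
- exact: PSL2_r2.
- pose r : SL2 R := SL2Of (r_det R); pose s : SL2 R := SL2Of (s_det 1).
  transitivity (PSL2_class
      (SL2_mul r (SL2_mul s (SL2_mul r (SL2_mul s (SL2_mul r s)))))).
    by rewrite -!PSL2_class_mul.
  (* In SL_2 the cube of $r s(1)$ is $-1$, which becomes trivial in PSL_2. *)
  apply: PSL2_class_eqN => /=.
  by rewrite !mul_mx22 [1%:M]mx22_eta opp_mx22 !mxE /=; congr mx22; ring.
Qed.

End Matrices22.

(** * The presentation over a discretely normed ring *)

Section DiscretelyNormedRing.
Variables (R : comNzRingType) (C : numDomainType) (j : {rmorphism R -> C}).
Variable tau : R.
Hypothesis span_tau : forall x : R, exists m l : int, x = m%:~R + tau *~ l.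
Hypothesis indep_tau :
  forall m l : int, m%:~R + tau *~ l = 0 -> m = 0 /\ l = 0.
(* Cohn's condition of a discrete norm. *)
Hypothesis small_j : forall x : R, `|j x| < 2 -> [\/ x = 0, x = 1 | x = -1].

Local Notation g := (PE2_gen_val tau).
Local Notation coeffs := (int * int)%type.

Definition lattice_elt (a : coeffs) : R := a.1%:~R + tau *~ a.2.
Local Notation L := lattice_elt.

Lemma lattice_elt_inj : injective L.
Proof.
move=> [m l] [m' l'] /eqP; rewrite -subr_eq0 /L /= => /eqP eq0.
have [] := @indep_tau (m - m') (l - l').
  by rewrite -[RHS]eq0 !mulrzBr opprD addrACA.
by move=> /subr0_eq -> /subr0_eq ->.
Qed.

(** Elements with nonzero image have absolute value at least 1. Two of them with product 1 thus have
    absolute value at most 1, below the bound 2 of the discrete norm. *)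
Lemma unit_pm1 (x y : R) : x * y = 1 -> x = 1 \/ x = -1.
Proof.
move=> xy1; have jxy : `|j x| * `|j y| = 1.
  by rewrite -normrM -rmorphM xy1 rmorph1 normr1.
have neq0 z : j z != 0 -> 1 <= `|j z|.
  move=> jz0; have [lt_z2|ge_z2] := real_ltP (normr_real (j z)) (@realn C 2).
    case: (small_j lt_z2) jz0 => ->; rewrite ?rmorph0 ?eqxx // => _.
      by rewrite rmorph1 normr1.
    by rewrite rmorphN1 normrN1.
  by apply: le_trans ge_z2; rewrite ler1n.
have: j x * j y != 0 by rewrite -rmorphM xy1 rmorph1 oner_eq0.
rewrite mulf_eq0 negb_or => /andP[jx0 jy0].
have lt_x2 : `|j x| < 2.
  apply: (@le_lt_trans _ _ 1); last by rewrite ltr1n.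
  by rewrite -[X in _ <= X]jxy ler_peMr ?neq0.
case: (small_j lt_x2); [move=> x0|by left|by right].
by move: jx0; rewrite x0 rmorph0 eqxx.
Qed.

Lemma eval_letter_power i x m :
  g i = PSL2_s x -> eval_word g (letter_power i m) = PSL2_s (x *~ m).
Proof.
move=> gi; have eval_nseq e n :
    eval_word g (nseq n (i, e)) = PSL2_s ((if e then - x else x) *+ n).
  elim: n => [|n IH]; first by rewrite PSL2_s0.
  by rewrite /= IH /eval_letter gi mulrS -PSL2_sD; case: e {IH}; rewrite ?PSL2_sV.
by case: m => n; rewrite eval_nseq // NegzE mulrNz mulNrn.
Qed.

Lemma eval_translation_word a : eval_word g (translation_word a) = PSL2_s (L a).
Proof.
rewrite eval_word_cat -PSL2_sD.
by congr (_ * _)%g; exact: eval_letter_power.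
Qed.

(** A lift to SL_2 of the value of a normal word, whose entries can be measured. *)
Fixpoint normal_mx (a : coeffs) (s : seq coeffs) : SL2 R :=
  if s is b :: s'
  then SL2_mul (SL2Of (s_det (L a))) (SL2_mul (SL2Of (r_det R)) (normal_mx b s'))
  else SL2Of (s_det (L a)).

Lemma eval_normal_word a s :
  eval_word g (normal_word a s) = PSL2_class (normal_mx a s).
Proof.
elim: s a => [|b s IH] a; first exact: eval_translation_word.
rewrite [normal_word _ _]/= eval_word_cat [eval_word g (_ :: _)]/= IH.
by rewrite eval_translation_word [normal_mx _ _]/= -!PSL2_class_mul.
Qed.

Lemma normal_mx_col a b s :
  normal_mx a (b :: s) 0 0 = L a * normal_mx b s 0 0 - normal_mx b s 1 0 /\
  normal_mx a (b :: s) 1 0 = normal_mx b s 0 0.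
Proof.
rewrite [normal_mx _ _]/= [SL2_val (SL2_mul _ _)]/=.
rewrite [SL2_val (normal_mx b s)]mx22_eta !mul_mx22 !mxE /=.
by split; ring.
Qed.

Lemma normal_mx_col_lt a s : reduced (a :: s) ->
  `|j (normal_mx a s 1 0)| < `|j (normal_mx a s 0 0)|.
Proof.
elim: s a => [|b s IH] a; first by rewrite !mxE rmorph0 rmorph1 normr0 normr1.
case/andP=> a_big red_bs; have [-> ->] := normal_mx_col a b s.
have {IH red_bs} := IH _ red_bs.
set x := normal_mx b s 0 0; set y := normal_mx b s 1 0 => lt_yx.
(* The list after [a] is nonempty, so [a] is not small; injectivity of [L] turns this into a bound
   on the absolute value. *)
have La2 : 2 <= `|j (L a)|.
  rewrite real_leNgt ?realn ?normr_real //; apply: contraL a_big => /small_j.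
  have L0 : L 0 = 0 by rewrite /L mulr0z addr0.
  have L1 : L (1, 0) = 1 by rewrite /L mulr0z addr0.
  have LN1 : L (-1, 0) = -1 by rewrite /L mulr0z addr0.
  rewrite /= negbK !inE => -[]; rewrite -?LN1 -?L0 -?L1 => /lattice_elt_inj->;
    by rewrite eqxx ?orbT.
rewrite rmorphB rmorphM; apply: lt_le_trans (lerB_dist _ _); rewrite normrM.
(* The chain is $|x| + |y| < 2|x| \le |a||x|$. *)
rewrite ltrBrDr; apply: (@lt_le_trans _ _ (`|j x| + `|j x|)).
  by rewrite ltrD2l.
by rewrite -mulr2n -mulr_natl ler_wpM2r.
Qed.

Lemma eval_eq1_presented w :
  eval_word g w = 1%g -> presented_eq PE2_relator w [::].
Proof.
have [a [s [red_s eq_w]]] := exists_normal_word w.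
rewrite (presented_eq_eval (@PE2_gen_relators _ tau) eq_w) eval_normal_word.
case: s red_s eq_w => [|b s] red_s eq_w /PSL2_class_eq1 [M10 M01].
  rewrite eq_w; move: M01; rewrite !mxE /= => /(_ erefl) La0.
  have -> : a = 0 by apply: lattice_elt_inj; rewrite La0 /L mulr0z addr0.
  exact: pe_refl.
(* The lower left entry is the top entry of the next column, which strictly dominates the other
   entry and so cannot vanish. *)
have [_ eq10] := normal_mx_col a b s.
have := normal_mx_col_lt red_s; rewrite -eq10 M10 rmorph0 normr0.
by rewrite normr_lt0.
Qed.

Lemma eval_word_PSL2_s x : exists w, eval_word g w = PSL2_s x.
Proof.
have [m [l ->]] := span_tau x.
by exists (translation_word (m, l)); exact: eval_translation_word.
Qed.

Lemma eval_word_upper (A : SL2 R) :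
  A 1 0 = 0 -> exists w, eval_word g w = PSL2_class A.
Proof.
(* The diagonal entries are inverse units, so both are 1 or both are -1; multiplying by this sign
   turns [A] into a translation by [A 0 0 * A 0 1]. *)
move=> A10; have [w eval_w] := eval_word_PSL2_s (A 0 0 * A 0 1).
exists w; rewrite eval_w; have := SL2_det_eq1 A; rewrite A10 mulr0 subr0 => A00A11.
have eqA := mx22_eta A; case: (unit_pm1 A00A11) => A00.
  congr PSL2_class; apply: SL2_eqP; rewrite /= eqA A10 A00 !mxE /= mul1r.
  by move: A00A11; rewrite A00 mul1r => ->.
apply: PSL2_class_eqN => /=; rewrite eqA A10 A00 opp_mx22 !mxE /= oppr0 mulN1r opprK.
by move: A00A11; rewrite A00 mulN1r => ->.
Qed.

(** Conjugation by the involution [r] exchanges lower and upper triangular classes. *)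
Lemma eval_word_lower (A : SL2 R) :
  A 0 1 = 0 -> exists w, eval_word g w = PSL2_class A.
Proof.
move=> A01; pose r : SL2 R := SL2Of (r_det R).
have [|w eval_w] := @eval_word_upper (SL2_mul r (SL2_mul A r)).
  rewrite /= [SL2_val A]mx22_eta !mul_mx22 !mxE /= A01; ring.
exists ([:: (gen_r, false)] ++ w ++ [:: (gen_r, false)]).
rewrite !eval_word_cat eval_w /= /eval_letter /= !mulg1 -!PSL2_class_mul.
by rewrite mulgA mulgA PSL2_r2 mul1g -mulgA PSL2_r2 mulg1.
Qed.

Lemma eval_word_elementary (A : SL2 R) :
  elementary_mx A -> exists w, eval_word g w = PSL2_class A.
Proof.
case.
- by move/is_diag_mxP=> dA; apply: eval_word_upper; exact: dA.
- by move/is_trig_mxP=> dA; apply: eval_word_lower; exact: dA.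
- by move/is_trig_mxP=> dA; apply: eval_word_upper; have := dA 0 1 isT; rewrite mxE.
move=> [e [s defA]].
have A_ i k : A i k = (-1) ^+ e i *+ (s i == k).
  by rewrite defA mul_diag_mx !mxE mulr_natr.
(* Either the permutation is trivial and [A] is diagonal, or left multiplication by [r] makes [A]
   diagonal. *)
have [s0|s0] := eqVneq (s 0) 0.
  by apply: eval_word_lower; rewrite A_ s0.
have s01 : s 0 = 1 by case: (ord2_case (s 0)) s0 => -> //; rewrite eqxx.
have s10 : s 1 = 0.
  case: (ord2_case (s 1)) => // s11.
  by have /perm_inj := etrans s01 (esym s11).
have [|w eval_w] := @eval_word_upper (SL2_mul (SL2Of (r_det R)) A).
  rewrite /= [SL2_val A]mx22_eta !mul_mx22 !mxE /= !A_ s01 s10 /=.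
  by rewrite !mulr0n; ring.
exists ([:: (gen_r, false)] ++ w).
rewrite eval_word_cat eval_w -PSL2_class_mul /= /eval_letter /= mulg1.
by rewrite mulgA PSL2_r2 mul1g.
Qed.

Lemma PE2_word w : PE2 (eval_word g w).
Proof.
have elem_s (a : R) : elementary_mx (mx22 1 a 0 1).
  apply: Or43; apply/is_trig_mxP => i k.
  by case: (ord2_case i) => ->; case: (ord2_case k) => -> // _; rewrite !mxE.
have PE2_s (a : R) : PE2 (PSL2_s a).
  by apply: sg_gen; exists (SL2Of (s_det a)) => //; exact: elem_s.
have PE2_r : PE2 (PSL2_r R).
  apply: sg_gen; exists (SL2Of (r_det R)) => //.
  (* The matrix [r] is the transposition with the sign of its first row changed. *)
  apply: Or44; exists (fun i => i == 0), (tperm 0 1).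
  rewrite mul_diag_mx; apply/matrixP => i k; rewrite !mxE.
  by case: (ord2_case i) => ->; case: (ord2_case k) => ->;
    rewrite ?tpermL ?tpermR /= ?mulr0 ?mulr1 ?mul1r.
elim: w => [|[i e] w IH]; first exact: sg_one.
apply: sg_mul IH; rewrite /eval_letter /=.
have PE2_g : PE2 (g i) by case: i; [exact: PE2_r | exact: PE2_s | exact: PE2_s].
by case: e; [exact: sg_inv|].
Qed.

Lemma PE2_is_word x : PE2 x -> exists w, eval_word g w = x.
Proof.
elim=> {x} [x [A elA ->]||x y _ [v <-] _ [w <-]|x _ [w <-]].
- exact: eval_word_elementary.
- by exists [::].
- by exists (v ++ w); exact: eval_word_cat.
- by exists (inv_word w); exact: eval_inv_word.
Qed.

Theorem discretely_normed_PE2_presentation :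
  has_presentation (@PE2 R) (PE2_gen_val tau) PE2_relator.
Proof.
split; [exact: PE2_word | exact: PE2_is_word |].
move=> v w; split.
  exact: (eval_presented_eq (@PE2_gen_relators _ tau) eval_eq1_presented).
exact: (presented_eq_eval (@PE2_gen_relators _ tau)).
Qed.

End DiscretelyNormedRing.

(** * The trace of a number field *)

Section Trace.
Variable K : fieldExtType rat.
Implicit Types x y : K.

(** The trace is independent of the basis: expanding one basis in the other gives a double sum that
    can be read in either order. *)
Lemma field_trace_coord n (e : n.-tuple K) x :
  basis_of fullv e -> field_trace x = \sum_(k < n) coord e k (x * e`_k).
Proof.
move=> be; have bv := vbasisP {:K}; set v := vbasis {:K} in bv.
transitivity (\sum_(i < \dim {:K}) \sum_(k < n) coord v i (x * e`_k) * coord e k v`_i).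
  apply: eq_bigr => i _; rewrite !mxE /= passmx.vecof_delta lfunE /=.
  rewrite {1}[v`_i](coord_basis be) ?memvf // mulr_sumr linear_sum.
  by apply: eq_bigr => k _; rewrite -scalerAr linearZ /= mulrC.
rewrite exchange_big; apply: eq_bigr => k _ /=.
rewrite [in RHS](coord_basis bv (memvf (x * e`_k))) linear_sum.
by apply: eq_bigr => i _; rewrite linearZ.
Qed.

Lemma field_traceD x y : field_trace (x + y) = field_trace x + field_trace y.
Proof.
rewrite !(field_trace_coord _ (vbasisP {:K})) -big_split.
by apply: eq_bigr => i _; rewrite mulrDl linearD.
Qed.

Lemma field_traceMz x (m : int) : field_trace (x *~ m) = field_trace x *~ m.
Proof.
rewrite !(field_trace_coord _ (vbasisP {:K})) mulrz_suml.
by apply: eq_bigr => i _; rewrite mulrzAl raddfMz.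
Qed.


End Trace.

Lemma sum_ord2 (V : nmodType) (F : 'I_2 -> V) : \sum_(i < 2) F i = F 0 + F 1.
Proof.
rewrite !big_ord_recl big_ord0 addr0; congr (_ + F _); exact: val_inj.
Qed.

(** * A quadratic order is generated by one element over the integers *)

Section QuadraticOrder.
Variables (K : fieldExtType rat) (O : subringClosed K).

Definition rat_free2 (x y : K) : Prop :=
  forall k l : rat, k *: x + l *: y = 0 -> k = 0 /\ l = 0.

Lemma integral_basis2 (b : 2.-tuple K) (x := b`_0) (y := b`_1) :
  integral_basis O b ->
  [/\ rat_free2 x y,
      forall z, exists k l : rat, z = k *: x + l *: y
    & forall z, z \in O <-> exists m l : int, z = x *~ m + y *~ l].
Proof.
case=> bb bO; split.
- move=> k l kl0; have /freeP/(_ (fun i => if i == 0 then k else l)) := basis_free bb.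
  by rewrite sum_ord2 /= => /(_ kl0) h; split; [apply: (h 0)|apply: (h 1)].
- move=> z; exists (coord b 0 z), (coord b 1 z).
  by rewrite {1}(coord_basis bb (memvf z)) sum_ord2.
move=> z; rewrite bO; split=> [[c ->]|[m [l ->]]].
  by exists (c 0), (c 1); rewrite sum_ord2.
exists (fun i => if i == 0 then m else l).
by rewrite sum_ord2.
Qed.

(* The equations express a unimodular change of basis between [x, y] and
   [1, w]. *)
Lemma exists_generator (b : 2.-tuple K) (x := b`_0) (y := b`_1) :
  integral_basis O b ->
  exists (w : K) (a c u v : int),
    [/\ u * a + v * c = 1, w = y *~ u - x *~ v,
        1 = x *~ a + y *~ c,
        x = u%:~R - w *~ c & y = v%:~R + w *~ a].
Proof.
move=> /integral_basis2; rewrite -/x -/y => -[free_xy _ memO].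
have [a [c def1]] := (memO 1).1 (rpred1 O).
have [u0 [v0 uv0]] := Bezoutz a c; set d := gcdz a c in uv0.
have [a' def_a] : exists a', a = a' * d by apply/dvdzP; exact: dvdz_gcdl.
have [c' def_c] : exists c', c = c' * d by apply/dvdzP; exact: dvdz_gcdr.
have [f df] : exists f, f * d = 1.
  (* [z = 1 / d] lies in [O], hence so does [z * x]. *)
  pose z := x *~ a' + y *~ c'.
  have zd : z *~ d = 1 by rewrite mulrzDl -!mulrzA -def_a -def_c -def1.
  have zO : z \in O by apply/memO; exists a', c'.
  have xO : x \in O by apply/memO; exists 1, 0; rewrite addr0.
  have [f [h zx]] := (memO (z * x)).1 (rpredM zO xO).
  exists f; have [] := @free_xy ((f * d)%:~R - 1) (h * d)%:~R.
    rewrite scalerBl scale1r !scaler_int !mulrzA addrAC -mulrzDl -zx -mulrzAl zd.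
    by rewrite mul1r subrr.
  by move=> /subr0_eq fd1 _; apply: (@intr_inj rat).
(* As $fd = 1$, scaling the Bezout identity by $f$ replaces the gcd by 1. *)
pose u := f * u0; pose v := f * v0.
have uv : u * a + v * c = 1 by rewrite -!mulrA -mulrDr uv0.
exists (y *~ u - x *~ v), a, c, u, v; split=> //.
- rewrite def1 mulrzDl mulrzBl -!mulrzA -{1}[x]mulr1z -uv mulrzDr.
  rewrite (mulrC a u) (mulrC c u); ring.
- rewrite def1 mulrzDl mulrzBl -!mulrzA -{1}[y]mulr1z -uv mulrzDr.
  rewrite (mulrC a v) (mulrC c v); ring.
Qed.

(** The given integral basis is exchanged for $1, w$ with $w^2 = m + lw$. Then $1$ and $w$ have
    traces $2$ and $l$, and $w^2$ has trace $2m + l^2$, so the trace form has determinant $l^2 +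
    4m$. *)
Lemma quadratic_order_generator (Delta : int) :
  \dim {:K} = 2 -> is_discriminant O Delta ->
  exists (w : K) (m l : int),
    [/\ w * w = m%:~R + w *~ l, Delta = l ^+ 2 + 4 * m, rat_free2 1 w,
        forall z : K, exists k h : rat, z = k *: 1 + h *: w
      & forall z, z \in O <-> exists k h : int, z = k%:~R + w *~ h].
Proof.
move=> dimK [n [b [bO discr]]]; have n2 : n = 2 by rewrite -dimK (size_basis bO.1).
subst n; have [w [a [c [u [v []]]]]] := exists_generator bO.
have [] := integral_basis2 bO.
set x := b`_0; set y := b`_1 => free_xy span_xy memO uv defw def1 defx defy.
have algE (q : rat) (z : K) : q *: z = in_alg K q * z by rewrite mulr_algl.
have span_w (k h : rat) : k *: x + h *: y =
    (k * u%:~R + h * v%:~R) *: 1 + (h * a%:~R - k * c%:~R) *: w.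
  by rewrite !algE rmorphB !rmorphD !rmorphM !rmorph_int defx defy; ring.
have memOw z : z \in O <-> exists k h : int, z = k%:~R + w *~ h.
  rewrite memO; split=> [[k [h ->]]|[k [h ->]]].
    exists (k * u + h * v), (h * a - k * c).
    move: (span_w k%:~R h%:~R); rewrite !scaler_int => ->.
    by rewrite -!intrM -intrD -intrB !scaler_int.
  exists (k * a - h * v), (k * c + h * u).
  by rewrite -[k%:~R]mulrzl [k%:~R * _]mulrC defw {1}def1; ring.
have free_w : rat_free2 1 w.
  move=> k h; rewrite def1 defw => kh0.
  have [] := @free_xy (k * a%:~R - h * v%:~R) (k * c%:~R + h * u%:~R).
    by rewrite -[RHS]kh0 !algE rmorphB !rmorphD !rmorphM !rmorph_int; ring.
  (* The Bezout identity inverts the change of basis and recovers [k] and [h] from the two vanishing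
     coefficients. *)
  have uvQ : u%:~R * a%:~R + v%:~R * c%:~R = 1 :> rat by rewrite -!intrM -intrD uv.
  move=> e1 e2; split.
    rewrite -[k]mulr1 -uvQ.
    transitivity (u%:~R * (k * a%:~R - h * v%:~R) +
                  v%:~R * (k * c%:~R + h * u%:~R)); first by ring.
    by rewrite e1 e2 !mulr0 addr0.
  rewrite -[h]mulr1 -uvQ.
  transitivity (a%:~R * (k * c%:~R + h * u%:~R) -
                c%:~R * (k * a%:~R - h * v%:~R)); first by ring.
  by rewrite e1 e2 !mulr0 subr0.
have wO : w \in O by apply/memOw; exists 0, 1; rewrite add0r.
have [m [l ww]] := (memOw (w * w)).1 (rpredM wO wO).
have bw : basis_of fullv [tuple 1; w].
  rewrite basisEdim; apply/andP; split; last by rewrite dimK.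
  apply/subvP => z _.
  have [k [h ->]] := span_xy z; rewrite span_w.
  by rewrite rpredD // rpredZ // memv_span // !inE eqxx ?orbT.
have coord0 : coord [tuple 1; w] 0 1 = 1 /\ coord [tuple 1; w] 0 w = 0.
  by have := coord_free 0 0 (basis_free bw); have := coord_free 1 0 (basis_free bw).
have coord1 : coord [tuple 1; w] 1 1 = 0 /\ coord [tuple 1; w] 1 w = 1.
  by have := coord_free 0 1 (basis_free bw); have := coord_free 1 1 (basis_free bw).
have tr1 : field_trace (1 : K) = 2.
  rewrite (field_trace_coord _ bw) sum_ord2 /= !mul1r.
  by rewrite coord0.1 coord1.2.
have trw : field_trace w = l%:~R.
  rewrite (field_trace_coord _ bw) sum_ord2 /= mulr1 ww.
  by rewrite linearD /= !raddfMz /= coord0.2 coord1.1 coord1.2 add0r mul0rz add0r.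
have tr_int (k h : int) : field_trace (k%:~R + w *~ h) = (2 * k + l * h)%:~R.
  by rewrite field_traceD !field_traceMz tr1 trw; ring.
exists w, m, l; split=> //; last first.
  move=> z; have [k [h ->]] := span_xy z; rewrite span_w.
  by eexists; eexists.
have prod_w (k h k' h' : int) : (k%:~R + w *~ h) * (k'%:~R + w *~ h') =
   (k * k' + m * (h * h'))%:~R + w *~ (k * h' + h * k' + l * (h * h')).
  transitivity ((k * k')%:~R + w *~ (k * h' + h * k') + (w * w) *~ (h * h')).
    by ring.
  by rewrite ww; ring.
apply: (@intr_inj rat); apply/esym; rewrite -discr (expand_det_row _ 0) sum_ord2.
rewrite /cofactor !det_mx11 !mxE /=.
rewrite -/x -/y defx -mulrNz defy !prod_w !tr_int.
(* A change of basis multiplies the determinant of the trace form by the square of its own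
   determinant, here 1. *)
transitivity (((u * a + v * c) ^+ 2 * (l ^+ 2 + 4 * m))%:~R : rat); last by ring.
by rewrite uv expr1n mul1r.
Qed.
End QuadraticOrder.

(** * Imaginary quadratic orders with $|\Delta| > 12$ are discretely normed *)

(* With [Delta = 4 q + p] and [2 z = A + h * sqrt Delta], the left-hand side
   is [4 |z|^2]. *)
Lemma norm_form_small (Delta q p k h : int) :
  Delta = 4 * q + p -> p = 0 \/ p = 1 -> Delta < -12 ->
  (2 * k + h * p) ^+ 2 - h ^+ 2 * Delta < 16 ->
  h = 0 /\ [\/ k = 0, k = 1 | k = -1].
Proof.
move=> defD p01 ltD; rewrite !expr2 => small.
have sq_ge0 : 0 <= (2 * k + h * p) * (2 * k + h * p) by rewrite -expr2 sqr_ge0.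
have hh_lt2 : h * h < 2.
  have : 0 <= h * h by rewrite -expr2 sqr_ge0.
  by nia.
have h0 : h = 0.
  have [//|h1] : h = 0 \/ h = 1 \/ h = -1 by nia.
  have hh : h * h = 1 by case: h1 => ->.
  have odd_sq : p = 1 -> 1 <= (2 * k + h * p) * (2 * k + h * p).
    by move=> ->; case: h1 => ->; nia.
  (* The residue modulo 4 sharpens $\Delta < -12$ to $\Delta \le -16$ or $\Delta \le -15$; in the
     second case the odd square supplies the missing 1. *)
  by case: p01 => p_val; [|move: (odd_sq p_val)]; nia.
split=> //; rewrite h0 in small.
have [|[|]] : k = 0 \/ k = 1 \/ k = -1 by nia.
- by constructor 1.
- by constructor 2.
- by constructor 3.
Qed.

(** The conjugate has the same square, so it agrees up to sign; equality would make the root real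
    and its square nonnegative. *)
Lemma sqrtC_conj_nonreal (Delta : int) :
  Delta < 0 -> (sqrtC Delta%:~R : algC)^* = - sqrtC Delta%:~R.
Proof.
move=> D0; set d : algC := sqrtC _; have dd : d ^+ 2 = Delta%:~R by exact: sqrtCK.
have : d^* ^+ 2 = d ^+ 2 by rewrite -rmorphXn dd rmorph_int.
move/eqP; rewrite eqf_sqr => /orP[] /eqP // dR.
have : 0 <= d ^+ 2 by rewrite real_exprn_even_ge0 // CrealE dR.
by rewrite dd ler0z leNgt D0.
Qed.

(** Completing the square in $w^2 = m + lw$ shows that $2\iota(w) - l$ is a square root of $\Delta$;
    a sign and an integer shift then turn $w$ into $\tau$. *)
Lemma quadratic_order_tau (K : fieldExtType rat) (O : subringClosed K)
    (Delta : int) (iota : {rmorphism K -> algC}) :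
  imaginary_quadratic K -> is_discriminant O Delta -> 12 < `|Delta| ->
  exists2 tau : K, tau \in O &
    [/\ iota tau = (if (2 %| Delta)%Z then sqrtC (Delta%:~R) / 2
                    else (1 + sqrtC (Delta%:~R)) / 2),
        forall x, x \in O -> exists m l : int, x = m%:~R + tau *~ l,
        forall m l : int, m%:~R + tau *~ l = 0 -> m = 0 /\ l = 0
      & forall x, x \in O -> `|iota x| < 2 -> [\/ x = 0, x = 1 | x = -1]].
Proof.
move=> [dimK imK] discr ltD.
have [w [m [l [ww defD free_w span_w memO]]]] := quadratic_order_generator dimK discr.
set d : algC := sqrtC _; have dd : d ^+ 2 = Delta%:~R by exact: sqrtCK.
pose y := 2 * iota w - l%:~R.
have yy : y ^+ 2 = d ^+ 2.
  rewrite dd defD; transitivity (4 * (iota w * iota w) - 4 * l%:~R * iota w + l%:~R ^+ 2).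
    by rewrite /y; ring.
  by rewrite -rmorphM ww rmorphD !rmorphMz rmorph1 /=; ring.
(* If [y] were real, so would be the image of [w], and hence that of all of [K]. *)
have yNreal : y \isn't Num.real.
  apply/negP => yR; have [x] := imK iota; move/negP; apply.
  have wR : iota w \is Num.real.
    have -> : iota w = (y + l%:~R) / 2 by rewrite /y; field.
    by apply: rpred_div; [apply: rpredD => //; exact: realz | exact: realn].
  have [k [h ->]] := span_w x; rewrite rmorphD !rmorphZ_num rmorph1 mulr1.
  apply: rpredD; first exact: rpred_rat.
  by apply: rpredM => //; exact: rpred_rat.
(* The embedding may send [w] to either root of its polynomial; [eps] records which. *)
have [eps eps2 defd] : exists2 eps : int, eps * eps = 1 & d = eps%:~R * y.
  have /eqP := yy; rewrite eqf_sqr => /orP[] /eqP->; [exists 1|exists (-1)] => //.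
    by rewrite mul1r.
  by rewrite mulN1r opprK.
have D_lt0 : Delta < 0.
  rewrite ltNge; apply: contra yNreal => D_ge0.
  have : d \is Num.real by rewrite ger0_real // sqrtC_ge0 ler0z.
  have -> : y = eps%:~R * d by rewrite defd mulrA -intrM eps2 mul1r.
  by move=> dR; rewrite rpredM ?realz.
have {}ltD : Delta < -12 by lia.
pose p : int := if (2 %| Delta)%Z then 0 else 1.
have p01 : p = 0 \/ p = 1 by rewrite /p; case: ifP; [left|right].
(* As $\Delta = l^2 + 4m$, the integers $l$ and $\Delta$ have the same parity. *)
have [h def_l] : exists h, l = 2 * h + p.
  pose h := (l %/ 2)%Z; pose e := (l %% 2)%Z.
  have def_l : l = 2 * h + e by rewrite /h /e; lia.
  have e01 : e = 0 \/ e = 1 by rewrite /e; lia.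
  exists h; suff -> : p = e by [].
  have defD' : Delta = 4 * (h * h + h * e + m) + e * e.
    by rewrite defD def_l; ring.
  by rewrite /p; case: e01 defD' => -> defD'; case: ifP; lia.
have [q defq] : exists q, Delta = 4 * q + p.
  exists (h * h + h * p + m); rewrite defD def_l.
  by case: p01 => ->; ring.
(* This shift is forced by $2\tau = p + d$ and $d = \epsilon(2w - l)$. *)
have [k defk] : exists k, p - eps * l = 2 * k.
  have [->|->] : eps = 1 \/ eps = -1 by nia.
    by exists (- h); rewrite def_l; ring.
  by exists (p + h); rewrite def_l; ring.
pose tau := w *~ eps + k%:~R; have iota_tau2 : 2 * iota tau = p%:~R + d.
  rewrite /tau rmorphD !rmorphMz rmorph1 defd /y /=.
  have -> : p = 2 * k + eps * l by lia.
  by ring.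
(* Since [eps] is its own inverse, $1, \tau$ spans the same lattice as $1, w$. *)
have defw : w = tau *~ eps - (k * eps)%:~R.
  rewrite /tau mulrzDl -!mulrzA eps2; ring.
exists tau; first by apply/memO; exists k, eps; rewrite addrC.
split.
- have -> : iota tau = (p%:~R + d) / 2 by rewrite -iota_tau2; field.
  by rewrite /p; case: ifP => _; rewrite ?add0r.
- move=> x /memO[a [b ->]]; exists (a - b * k * eps), (b * eps).
  by rewrite {1}defw; ring.
- move=> a b; rewrite /tau => ab0.
  have [] := @free_w (a + b * k)%:~R (b * eps)%:~R.
    rewrite !scaler_int -[RHS]ab0; ring.
  move=> /eqP; rewrite intr_eq0 => /eqP e1 /eqP; rewrite intr_eq0 => /eqP e2.
  have b0 : b = 0 by rewrite -[b]mulr1 -eps2 mulrA e2 mul0r.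
  by move: e1; rewrite b0 mul0r addr0.
move=> x /memO[a0 [b0 ->]].
have -> : a0%:~R + w *~ b0 = (a0 - b0 * k * eps)%:~R + tau *~ (b0 * eps).
  by rewrite {1}defw; ring.
move: (a0 - _ : int) (b0 * eps : int) => a b; set x' := _ + _ => lt2.
(* Here $2x' = (2a + bp) + bd$ and conjugation negates $d$, so the product with the conjugate is a
   difference of squares. *)
have norm4 : (4 * (`|iota x'| ^+ 2) : algC) =
    ((2 * a + b * p) ^+ 2 - b ^+ 2 * Delta)%:~R.
  transitivity ((2 * iota x') * (2 * iota x')^*).
    by rewrite rmorphM rmorph_nat normCK; ring.
  have -> : 2 * iota x' = (2 * a + b * p)%:~R + b%:~R * d.
    rewrite /x' rmorphD !rmorphMz rmorph1 /=.
    transitivity (2 * a%:~R + b%:~R * (2 * iota tau)); first by ring.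
    by rewrite iota_tau2; ring.
  move: (2 * a + b * p) => A; rewrite rmorphD rmorphM !rmorph_int.
  rewrite [X in _ * (_ + _ * X)](sqrtC_conj_nonreal D_lt0) -/d.
  transitivity (A%:~R ^+ 2 - b%:~R ^+ 2 * d ^+ 2); first by ring.
  by rewrite dd; ring.
have lt16 : (2 * a + b * p) ^+ 2 - b ^+ 2 * Delta < 16.
  rewrite -(ltr_int algC) -norm4.
  have -> : (16%:~R : algC) = 4 * 2 ^+ 2 by ring.
  by rewrite ltr_pM2l ?ltr0n // ltr_pXn2r ?nnegrE ?normr_ge0 ?ler0n.
have [b0' a01] := norm_form_small defq p01 ltD lt16.
by rewrite /x' b0' mulr0z addr0; case: a01 => ->; constructor.
Qed.

(** * Transfer to the order as a ring in its own right *)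

Theorem corollary1p4 (K : fieldExtType rat) (O : subringClosed K) (Delta : int)
    (iota : {rmorphism K -> algC}) :
  imaginary_quadratic K ->
  is_order O ->
  is_discriminant O Delta ->
  12 < `|Delta| ->
  exists tau : ring_of O,
    iota (ring_val tau) =
      (if (2 %| Delta)%Z then sqrtC (Delta%:~R) / 2
       else (1 + sqrtC (Delta%:~R)) / 2) /\
    has_presentation (@PE2 (ring_of O)) (PE2_gen_val tau) PE2_relator.
Proof.
move=> imK _ discr ltD.
have [t tO [iota_t span_t free_t small_t]] :=
  quadratic_order_tau iota imK discr ltD.
pose tau : ring_of O := RingOf tO; exists tau; split=> //.
have val_lin (m l : int) : val (m%:~R + tau *~ l) = m%:~R + t *~ l.
  by rewrite raddfD !raddfMz.
(* The discrete norm is the complex absolute value restricted to the order. *)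
pose j : {rmorphism ring_of O -> algC} := iota \o val.
apply: (@discretely_normed_PE2_presentation _ _ j).
- move=> x; have [m [l def_x]] := span_t _ (valP x).
  by exists m, l; apply: val_inj; rewrite val_lin.
- by move=> m l /(congr1 val); rewrite val_lin raddf0; exact: free_t.
- move=> x /(small_t _ (valP x)) [] def_x; [apply: Or31|apply: Or32|apply: Or33];
    by apply: val_inj; rewrite def_x ?raddf0 ?rmorphN1 ?rmorph1.
Qed.
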